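(* For every integer $k\ge 1$ $$F_{2k}=\sum_{s=0}^{\lfloor\frac{k-1}{2}\rfloor}\sum_{m=0}^{k-2s-1}\binom{k-s-m-1}{s}\binom{m+s}{m}2^m.$$
   Context: $\{F_k\}_{k\ge 0}$ is the Fibonacci sequence: $F_0=0$, $F_1=1$, $F_{k+1}=F_k+F_{k-1}$ for $k\ge 1$. *)

(* Defs.v *)
From mathcomp Require Import all_boot.

Set Implicit Arguments.
Unset Strict Implicit.
Unset Printing Implicit Defensive.

(* Indexed so that fib 0 = 0 and fib 1 = 1; the function [fibonacci] of
   Stdlib's Zgcd_alt is Z-valued and shifted by one (it starts 1, 1). *)
Fixpoint fib (n : nat) : nat :=
  match n with
  | 0 => 0
  | p.+1 => match p with 0 => 1 | q.+1 => fib p + fib q end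
  end.

(* Main.v *)
Require Import Defs.
From mathcomp Require Import all_boot.
From mathcomp Require Import zify.

(** Write k = n + 1 and P = (1 - x)(1 - 2x).  The inner sum is the
    coefficient of x^(n - s) in the convolution x^s / P^(s+1) of
    x^s / (1 - x)^(s+1), whose coefficients are 'C(j, s), with
    1 / (1 - 2x)^(s+1), whose coefficients are 'C(m + s, m) 2^m.  Hence the
    double sum is the coefficient of x^n in the geometric series
      sum over s of x^(2s) / P^(s+1) = 1 / (P - x^2) = 1 / (1 - 3x + x^2),
    and that last fraction generates fib (2 n + 2).

    The proof below carries this out on coefficients.  Multiplying by 1 - x or
    1 - 2x is a Pascal-type recurrence ([conv_pascal_l], [conv_pascal_r]);
    multiplying by P combines the two ([conv_rec]); summing the geometric
    series turns this into the recurrence u(n+2) + u(n) = 3 u(n+1), which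
    even-indexed Fibonacci numbers satisfy. *)

(** The coefficient of x^n in x^s / ((1 - x)^(s+1) (1 - 2x)^(t+1)).  The two
    exponents are kept independent so that one factor of the denominator can
    be removed at a time. *)
Definition conv (s t n : nat) : nat :=
  \sum_(m < n.+1) 'C(n - m, s) * 'C(m + t, m) * 2 ^ m.

Lemma conv_small s t n : n < s -> conv s t n = 0.
Proof. by move=> lt_ns; apply: big1 => m _; rewrite bin_small //; lia. Qed.

(** Multiplication of the generating series by 1 - x. *)
Lemma conv_pascal_l s t n :
  conv s.+1 t n.+1 = conv s.+1 t n + conv s t n.
Proof.
rewrite /conv big_ord_recr /= subnn bin0n !mul0n addn0 -big_split /=.
apply: eq_bigr => m _.
by rewrite subSn ?binS ?mulnDl // -ltnS.
Qed.

(** Multiplication of the generating series by 1 - 2x. *)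
Lemma conv_pascal_r s t n :
  conv s t.+1 n.+1 = 2 * conv s t.+1 n + conv s t n.+1.
Proof.
rewrite /conv [LHS]big_ord_recl [\sum_(m < n.+2) _]big_ord_recl /= !bin0.
rewrite addnCA; congr (_ + _); rewrite big_distrr -big_split /=.
apply: eq_bigr => m _; rewrite /bump /= !add1n subSS !addSn !addnS binS expnS.
lia.
Qed.

(** The identity P * (x^(s+1) / P^(s+2)) = x * (x^s / P^(s+1)) for
    P = 1 - 3x + 2x^2, read off at x^(n+2). *)
Lemma conv_rec s n :
  conv s.+1 s.+1 n.+2 + 2 * conv s.+1 s.+1 n =
    3 * conv s.+1 s.+1 n.+1 + conv s s n.+1.
Proof.
have := conv_pascal_r s.+1 s n.+1; have := conv_pascal_r s.+1 s n.
have := conv_pascal_l s s n.+1; lia.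
Qed.

Lemma conv00S n : conv 0 0 n.+1 = conv 0 0 n + 2 ^ n.+1.
Proof.
rewrite /conv big_ord_recr /= bin0 addn0 binn !mul1n; congr (_ + _).
by apply: eq_bigr => m _; rewrite !bin0.
Qed.

Lemma conv000 : conv 0 0 0 = 1.
Proof. by rewrite /conv big_ord1. Qed.

(** The coefficient of x^n in x^(2s) / ((1 - x)(1 - 2x))^(s+1).  Truncation of
    n - s is harmless: for n < s the value is conv s s 0 with s > 0, that
    is 0. *)
Definition geom_term (s n : nat) : nat := conv s s (n - s).

Lemma geom_term_small s n : n < 2 * s -> geom_term s n = 0.
Proof. by move=> lt_n2s; apply: conv_small; lia. Qed.

Lemma geom_term_rec s n :
  geom_term s.+1 n.+2 + 2 * geom_term s.+1 n =
    3 * geom_term s.+1 n.+1 + geom_term s n.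
Proof.
rewrite /geom_term !subSS; have [lt_sn | le_ns] := ltnP s n.
  have -> : n.+1 - s = (n - s.+1).+2 by lia.
  have -> : n - s = (n - s.+1).+1 by lia.
  exact: conv_rec.
(* For n <= s all terms vanish, unless s = n = 0. *)
have [s0 | s_gt0] := posnP s.
  have -> : n = 0 by lia.
  by rewrite s0 /conv !big_ord_recr !big_ord0.
by rewrite !conv_small //; lia.
Qed.

Lemma geom_term0_rec n :
  geom_term 0 n.+2 + 2 * geom_term 0 n = 3 * geom_term 0 n.+1.
Proof.
by rewrite /geom_term !subn0; have := conv00S n.+1; rewrite !conv00S !expnS; lia.
Qed.

(** The series is cut at one bound N for all three coefficients, so that the
    recurrences of its terms add up; n < N ensures that the shift of s by one
    loses only a zero term. *)
Lemma geom_sum_rec N n : n < N ->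
  \sum_(s < N.+1) geom_term s n.+2 + \sum_(s < N.+1) geom_term s n =
    3 * \sum_(s < N.+1) geom_term s n.+1.
Proof.
move=> lt_nN.
have recN : \sum_(s < N) geom_term s.+1 n.+2
          + 2 * \sum_(s < N) geom_term s.+1 n
          = 3 * \sum_(s < N) geom_term s.+1 n.+1 + \sum_(s < N) geom_term s n.
  rewrite !big_distrr -!big_split /=.
  by apply: eq_bigr => s _; exact: geom_term_rec.
have headE i : \sum_(s < N.+1) geom_term s i
             = geom_term 0 i + \sum_(s < N) geom_term s.+1 i.
  by rewrite big_ord_recl.
have lastE : \sum_(s < N.+1) geom_term s n = \sum_(s < N) geom_term s n.
  by rewrite big_ord_recr /= geom_term_small ?addn0 //; lia.
have := (geom_term0_rec n, (headE n, headE n.+1, headE n.+2)) => -[? [[? ?] ?]].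
lia.
Qed.

Lemma fib_rec2 n : fib n.+4 + fib n = 3 * fib n.+2.
Proof. by rewrite /=; case: n => [|n] /=; lia. Qed.

Lemma geom_sum_fib N n : n <= N ->
  \sum_(s < N.+1) geom_term s n = fib (2 * n.+1).
Proof.
(* Below x^2 only the term s = 0 of the geometric series contributes. *)
have base i : i < 2 -> \sum_(s < N.+1) geom_term s i = conv 0 0 i.
  move=> lt_i2; rewrite big_ord_recl big1 => [|s _].
    by rewrite addn0 /geom_term subn0.
  by apply: geom_term_small; rewrite /= /bump; lia.
elim/ltn_ind: n => -[|[|n]] IHn le_nN.
- by rewrite base // conv000.
- by rewrite base // conv00S conv000.
have := geom_sum_rec N n (ltnW le_nN).
rewrite (IHn n) ?(IHn n.+1) ?(ltnW le_nN) ?(ltnW (ltnW le_nN)) //.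
have := fib_rec2 (2 * n.+1).
have -> : 2 * n.+3 = (2 * n.+1).+4 by lia.
have -> : 2 * n.+2 = (2 * n.+1).+2 by lia.
lia.
Qed.

Theorem corollary4p9 (k : nat) (hk : 1 <= k) :
  fib (2 * k) =
    \sum_(0 <= s < ((k - 1) %/ 2).+1)
      \sum_(0 <= m < (k - 2 * s - 1).+1)
        'C(k - s - m - 1, s) * 'C(m + s, m) * 2 ^ m.
Proof.
case: k hk => // n _; rewrite -(geom_sum_fib n n) //.
rewrite -(big_mkord xpredT (geom_term^~ n)).
(* The terms dropped by the bounds n / 2 on s and n - 2 s on m vanish. *)
rewrite (@big_cat_nat _ _ _ (n %/ 2).+1) //=; last by lia.
rewrite [X in _ + X]big_nat_cond [X in _ + X]big1 ?addn0; last first.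
  by move=> s /andP[/andP[? _] _]; apply: geom_term_small; lia.
rewrite subn1 /=; apply: eq_big_nat => s /andP[_ lt_s].
rewrite /geom_term /conv.
rewrite -(big_mkord xpredT (fun m => 'C(n - s - m, s) * 'C(m + s, m) * 2 ^ m)).
rewrite (@big_cat_nat _ _ _ (n.+1 - 2 * s - 1).+1) //=; last by lia.
rewrite [X in _ + X]big_nat_cond [X in _ + X]big1 ?addn0; last first.
  by move=> m /andP[/andP[? ?] _]; rewrite bin_small //; lia.
apply: eq_big_nat => m /andP[_ lt_m].
by congr ('C(_, _) * _ * _); lia.
Qed.
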